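(* Let $M_0$ be an r-framed, 2-ruled, Cayley cone in $\mathbb{R}^8$ defined by maps $\phi_1,\phi_2:\Sigma\to\mathcal{S}^7$ in the flat gauge, where $\Sigma$ is a Riemann surface. Let $w$ be a holomorphic vector field on $\Sigma$ and define $\psi:\Sigma\to\mathbb{R}^8$ by $\psi=\mathcal{L}_w\phi_1+\mathcal{L}_{iw}\phi_2$, where $\mathcal{L}_w,\mathcal{L}_{iw}$ denote the Lie derivatives with respect to $w,iw$. Let $$M=\{r_1\phi_1(\sigma)+r_2\phi_2(\sigma)+\psi(\sigma):r_1,r_2\in\mathbb{R},\ \sigma\in\Sigma\}.$$ Then $M$ is an r-framed 2-ruled Cayley 4-fold in $\mathbb{R}^8$.
   Context: Write $d\mathbf{x}_{ijkl}=dx_i\wedge dx_j\wedge dx_k\wedge dx_l$ and let $\Phi$ be the 4-form on $\mathbb{R}^8$ $$\Phi=d\mathbf{x}_{1234}+d\mathbf{x}_{1256}+d\mathbf{x}_{1278}+d\mathbf{x}_{1357}-d\mathbf{x}_{1368}-d\mathbf{x}_{1458}-d\mathbf{x}_{1467}+d\mathbf{x}_{5678}+d\mathbf{x}_{3478}+d\mathbf{x}_{3456}+d\mathbf{x}_{2468}-d\mathbf{x}_{2457}-d\mathbf{x}_{2367}-d\mathbf{x}_{2358}.$$ A 4-dimensional submanifold of $\mathbb{R}^8$ is Cayley if, for a suitable orientation, $\Phi$ restricts to the Riemannian volume form on each of its tangent spaces. The triple cross product on $\mathbb{R}^8$ is defined by $g(x\times y\times z,w)=\Phi(x,y,z,w)$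 for all $w$, with $g$ the Euclidean metric. A 2-ruled 4-fold is an (immersed) 4-dimensional submanifold with a smooth map $\pi:M\to\Sigma$ to a 2-manifold whose fibres are affine 2-planes; it is r-framed if an oriented orthonormal basis $(\phi_1(\sigma),\phi_2(\sigma))$ of each fibre direction is chosen smoothly. It is then the image of $\iota_M(r_1,r_2,\sigma)=r_1\phi_1(\sigma)+r_2\phi_2(\sigma)+\psi(\sigma)$ on $\mathbb{R}^2\times\Sigma$; singularities (points where $\iota_M$ is not an immersion) are allowed, and ''Cayley'' refers to the points where it is an immersion. The r-framed 2-ruled cone defined by the orthogonal smooth maps $\phi_1,\phi_2$ is $M_0=\{r_1\phi_1(\sigma)+r_2\phi_2(\sigma):\sigma\in\Sigma,\ r_1,r_2\in\mathbb{R}\}$. The complex structure of the Riemann surface $\Sigma$ is the one adapted to $M_0$: together with the flat gauge condition this means that for every local holomorphic coordinate $s+it$ on $\Sigma$, $$\frac{\partial\phi_j}{\partial t}=\phi_1\times\phi_2\times\frac{\partial\phi_j}{\partial s},\qquad \frac{\partial\phi_j}{\partial s}=-\phi_1\times\phi_2\times\frac{\partial\phi_j}{\partial t}\qquad (j=1,2).$$ A holomorphic vector field $w$ is regarded as a real vector field: locally $w=u\,\partial_s+v\,\partial_t$ with $u+iv$ holomorphic in $s+it$, and $iw=Jw=-v\,\partial_s+u\,\partial_t$. *)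

(* Defs.v *)
From HB Require Import structures.
From mathcomp Require Import all_boot all_order all_algebra.
From mathcomp Require Import all_classical all_reals all_analysis.

Set Implicit Arguments.
Unset Strict Implicit.
Unset Printing Implicit Defensive.
Import Order.TTheory GRing.Theory Num.Theory.
Import numFieldNormedType.Exports.
Local Open Scope classical_set_scope.
Local Open Scope ring_scope.

Section Euclidean8.
Variable R : realType.

Definition euclid (x y : 'rV[R]_8) : R := \sum_(i < 8) x 0 i * y 0 i.

(* The value of dx_i /\ dx_j /\ dx_k /\ dx_l on the rows of V; coordinates are
   numbered from 1 to 8. *)
Definition dx (i j k l : nat) (V : 'M[R]_(4, 8)) : R :=
  \det (\matrix_(a < 4, b < 4) V a (inord (nth 0%N [:: i; j; k; l] b).-1)).

Definition Phi (V : 'M[R]_(4, 8)) : R :=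
  dx 1 2 3 4 V + dx 1 2 5 6 V + dx 1 2 7 8 V + dx 1 3 5 7 V
  - dx 1 3 6 8 V - dx 1 4 5 8 V - dx 1 4 6 7 V
  + dx 5 6 7 8 V + dx 3 4 7 8 V + dx 3 4 5 6 V + dx 2 4 6 8 V
  - dx 2 4 5 7 V - dx 2 3 6 7 V - dx 2 3 5 8 V.

Definition rows4 (x y z w : 'rV[R]_8) : 'M[R]_(4, 8) :=
  \matrix_(a < 4) nth 0 [:: x; y; z; w] a.

(* The components of x * y * z in the standard basis; [cross3P] below is the
   defining property of the triple cross product. *)
Definition cross3 (x y z : 'rV[R]_8) : 'rV[R]_8 :=
  \row_(i < 8) Phi (rows4 x y z (delta_mx 0 i)).

Lemma dx_linear i j k l (x y z w : 'rV[R]_8) :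
  dx i j k l (rows4 x y z w) =
  \sum_(m < 8) dx i j k l (rows4 x y z (delta_mx 0 m)) * w 0 m.
Proof.
pose a3 : 'I_4 := ord_max.
rewrite /dx (expand_det_row _ a3).
under [RHS]eq_bigr => m _ do rewrite (expand_det_row _ a3) big_distrl /=.
rewrite exchange_big /=; apply: eq_bigr => b _.
rewrite !mxE /=; set h := inord _.
rewrite (bigD1 h)//= big1 ?addr0 => [|m /negbTE m_h]; last first.
  by rewrite !mxE /= eq_sym m_h !mul0r.
rewrite !mxE /= eqxx mul1r mulrC; congr (_ * _).
rewrite /cofactor; congr (_ * \det _).
apply/matrixP => a b'; rewrite !mxE.
have : (lift a3 a < 3)%N by rewrite lift_max; exact: ltn_ord.
by case: (nat_of_ord (lift a3 a)) => [|[|[|]]].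
Qed.

Lemma cross3P (x y z w : 'rV[R]_8) : euclid (cross3 x y z) w = Phi (rows4 x y z w).
Proof.
rewrite /euclid [RHS]/Phi; under eq_bigr => i _ do rewrite mxE /Phi !mulrDl !mulNr.
by rewrite !big_split /= !sumrN -!dx_linear.
Qed.

End Euclidean8.

(* The complex line C with coordinate s + it, as a real normed space. *)
Definition plane (R : realType) : normedModType R := (R^o * R^o)%type.

Section Calculus.
Variables (R : realType) (W : normedModType R).
Implicit Types (f : plane R -> W) (U : set (plane R)).

Definition ds f (z : plane R) : W := 'D_((1, 0) : plane R) f z.
Definition dt f (z : plane R) : W := 'D_((0, 1) : plane R) f z.

Definition dvec (a : plane R) f (z : plane R) : W := a.1 *: ds f z + a.2 *: dt f z.

Fixpoint Cn_on (n : nat) U f : Prop :=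
  match n with
  | 0 => forall z, U z -> {for z, continuous f}
  | n'.+1 => [/\ forall z, U z -> differentiable f z,
                 Cn_on n' U (ds f) & Cn_on n' U (dt f)]
  end.

Definition smooth_on U f : Prop := forall n, Cn_on n U f.

End Calculus.

Definition mul_i (R : realType) (a : plane R) : plane R := (- a.2, a.1).

(* Smooth functions satisfying the Cauchy-Riemann equation df/dt = i df/ds. *)
Definition holo_on (R : realType) (U : set (plane R)) (f : plane R -> plane R) :=
  smooth_on U f /\ forall z, U z -> dt f z = mul_i (ds f z).

(* Charts are total functions; only the values of [coord] on [cdom] and of
   [cinv] on [ccod] are meaningful. *)
Record chart (R : realType) (S : topologicalType) := Chart {
  cdom : set S;
  coord :> S -> plane R;
  cinv : plane R -> S;
  cdom_open : open cdom;
  ccod_open : open (coord @` cdom);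
  coordK : forall x, cdom x -> cinv (coord x) = x;
  coord_continuous : forall x, cdom x -> {for x, continuous coord};
  cinv_continuous : forall x, cdom x -> {for coord x, continuous cinv} }.

Definition ccod (R : realType) (S : topologicalType) (c : chart R S) :
  set (plane R) := c @` cdom c.

Definition holo_transition (R : realType) (S : topologicalType)
    (c c' : chart R S) : Prop :=
  holo_on (c @` (cdom c `&` cdom c')) (c' \o cinv c).

(* The atlas is maximal, so its charts are exactly the local holomorphic
   coordinates. *)
Record riemann_surface (R : realType) (S : topologicalType) := RiemannSurface {
  atlas : set (chart R S);
  atlas_cover : forall x, exists2 c, atlas c & cdom c x;
  atlas_holo : forall c c', atlas c -> atlas c' -> holo_transition c c';
  atlas_max : forall c,
    (forall c', atlas c' -> holo_transition c c' /\ holo_transition c' c) ->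
    atlas c;
  surface_hausdorff : hausdorff_space S;
  surface_second_countable : @second_countable S }.

Section Surface.
Variables (R : realType) (S : topologicalType) (X : riemann_surface R S).
Local Notation chart := (chart R S).
Local Notation plane := (plane R).
Local Notation R8 := 'rV[R]_8.

Definition chart_at (x : S) : chart := s2val (cid2 (atlas_cover X x)).

Definition smooth (f : S -> R8) : Prop :=
  forall c, atlas X c -> smooth_on (ccod c) (f \o cinv c).

(* A vector field is given by its components: [w c x = (u, v)] means that
   w = u d/ds + v d/dt at x, where s + it is the coordinate c. *)
Definition holo_vector_field (w : chart -> S -> plane) : Prop :=
  (forall c, atlas X c -> holo_on (ccod c) (w c \o cinv c)) /\
  (forall c c' x, atlas X c -> atlas X c' -> cdom c x -> cdom c' x ->
     w c' x = dvec (w c x) (c' \o cinv c) (c x)).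

Definition vf_i (w : chart -> S -> plane) : chart -> S -> plane :=
  fun c x => mul_i (w c x).

Definition lie (w : chart -> S -> plane) (f : S -> R8) (x : S) : R8 :=
  let c := chart_at x in dvec (w c x) (f \o cinv c) (c x).

Definition iota (phi1 phi2 psi : S -> R8) (p : plane * S) : R8 :=
  p.1.1 *: phi1 p.2 + p.1.2 *: phi2 p.2 + psi p.2.

(* Rows: the derivatives of F along r1, r2, s, t, where s + it = c. *)
Definition jac (c : chart) (F : plane * S -> R8) (p : plane * S) : 'M[R]_(4, 8) :=
  \matrix_(a < 4)
    'D_(nth (0 : plane * plane)
          [:: ((1, 0), (0, 0)); ((0, 1), (0, 0));
              ((0, 0), (1, 0)); ((0, 0), (0, 1))] a)
      (fun q : plane * plane => F (q.1, cinv c q.2)) (p.1, c p.2).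

Definition immersed_at (F : plane * S -> R8) (p : plane * S) : Prop :=
  exists c, [/\ atlas X c, cdom c p.2 & row_free (jac c F p)].

(* The holomorphic charts orient R^2 x Sigma, so an orientation of an open
   subset is a locally constant comparison [o] with that orientation ([true]
   meaning opposite). Phi restricts to the volume form iff it takes the value 1
   on every positively oriented orthonormal basis (the rows of E) of every
   tangent space (the row space of the Jacobian); such a basis exists only at
   points where F is an immersion. *)
Definition cayley (F : plane * S -> R8) : Prop :=
  exists o : plane * S -> bool,
    (forall p, immersed_at F p ->
       \forall q \near p, immersed_at F q -> o q = o p) /\
    (forall p c (A : 'M[R]_4), atlas X c -> cdom c p.2 ->
       let E := A *m jac c F p in
       E *m E^T = 1%:M -> 0 < (-1) ^+ o p * \det A -> Phi E = 1).

Record framed_2ruled (phi1 phi2 psi : S -> R8) (M : set R8) : Prop := {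
  framed_smooth1 : smooth phi1;
  framed_smooth2 : smooth phi2;
  framed_smooth : smooth psi;
  framed_unit1 : forall x, euclid (phi1 x) (phi1 x) = 1;
  framed_unit2 : forall x, euclid (phi2 x) (phi2 x) = 1;
  framed_orth : forall x, euclid (phi1 x) (phi2 x) = 0;
  framed_image : M = range (iota phi1 phi2 psi);
  (* M is 4-dimensional away from the singular points. *)
  framed_immersed : dense (immersed_at (iota phi1 phi2 psi)) }.

Definition framed_2ruled_cayley (phi1 phi2 psi : S -> R8) (M : set R8) : Prop :=
  framed_2ruled phi1 phi2 psi M /\ cayley (iota phi1 phi2 psi).

(* The complex structure is adapted to the cone and (phi1, phi2) is in the flat
   gauge. *)
Definition adapted_flat_gauge (phi1 phi2 : S -> R8) : Prop :=
  forall c x, atlas X c -> cdom c x ->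
  forall phi, phi = phi1 \/ phi = phi2 ->
    dt (phi \o cinv c) (c x) =
      cross3 (phi1 x) (phi2 x) (ds (phi \o cinv c) (c x)) /\
    ds (phi \o cinv c) (c x) =
      - cross3 (phi1 x) (phi2 x) (dt (phi \o cinv c) (c x)).

End Surface.

(* Main.v *)
From HB Require Import structures.
Require Import Defs.
From mathcomp Require Import all_boot all_order all_algebra.
From mathcomp Require Import all_classical all_reals all_analysis.
From mathcomp Require Import ring lra.

(* In a local holomorphic coordinate s + it, write x, y for the ruling
   directions, a, b for their s-derivatives and J v for [cross3 x y v]. The flat
   gauge says that the t-derivatives of x, y are J a, J b. For the translation
   part g = L_w x + L_(iw) y, expand g_t - J g_s with w = u + iv: the first
   order terms cancel by the Cauchy-Riemann equations, and differentiating the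
   gauge equations (second derivatives commute) turns the rest into
     u (x*b*a + Ja*y*b + x*Jb*b) + v (Ja*y*a + x*Jb*a - a*y*b),
   which lies in the span of x and y by the double cross product identity
   [cross3_double]. So every tangent space of M is spanned by x, y, some
   vector z orthogonal to both, and J z, and such a plane is Cayley because J is
   an isometry on the orthogonal complement of x and y. Singular points form a
   set with dense complement: where a, b do not both vanish (a dense set, as the
   cone is immersed on a dense set), the r-plane contains an immersed point
   arbitrarily close to any given one, since z depends on r affinely with
   linear part r1 a + r2 b. *)

Set Implicit Arguments.
Unset Strict Implicit.
Unset Printing Implicit Defensive.
Import Order.TTheory GRing.Theory Num.Theory.
Import numFieldNormedType.Exports.
Local Open Scope classical_set_scope.
Local Open Scope ring_scope.

(** * Polynomial identities for the 4-form and the triple product in coordinates *)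

Section Coordinates.
Variable K : comRingType.
Implicit Types x y z w : nat -> K.

Definition minor3 x y z i j k : K :=
  x i * (y j * z k - y k * z j) - x j * (y i * z k - y k * z i)
  + x k * (y i * z j - y j * z i).

(** Laplace expansion along the last row, which isolates the argument that [cross8] dualizes. *)
Definition minor4 x y z w i j k l : K :=
  minor3 x y z i j k * w l - minor3 x y z i j l * w k
  + minor3 x y z i k l * w j - minor3 x y z j k l * w i.

Definition dot8 x y : K :=
  x 1 * y 1 + x 2 * y 2 + x 3 * y 3 + x 4 * y 4
  + x 5 * y 5 + x 6 * y 6 + x 7 * y 7 + x 8 * y 8.

(* Indices run from 1 to 8, as in [dx]; other values of [n] give 0. *)
Definition cross8 x y z (n : nat) : K :=
  let d := minor3 x y z in
  match n with
  | 1 => - d 2 3 4 - d 2 5 6 - d 2 7 8 - d 3 5 7 + d 3 6 8 + d 4 5 8 + d 4 6 7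
  | 2 => d 1 3 4 + d 1 5 6 + d 1 7 8 - d 4 6 8 + d 4 5 7 + d 3 6 7 + d 3 5 8
  | 3 => - d 1 2 4 + d 1 5 7 - d 1 6 8 - d 4 7 8 - d 4 5 6 - d 2 6 7 - d 2 5 8
  | 4 => d 1 2 3 - d 1 5 8 - d 1 6 7 + d 3 7 8 + d 3 5 6 + d 2 6 8 - d 2 5 7
  | 5 => - d 1 2 6 - d 1 3 7 + d 1 4 8 - d 6 7 8 - d 3 4 6 + d 2 4 7 + d 2 3 8
  | 6 => d 1 2 5 + d 1 3 8 + d 1 4 7 + d 5 7 8 + d 3 4 5 - d 2 4 8 + d 2 3 7
  | 7 => - d 1 2 8 + d 1 3 5 - d 1 4 6 - d 5 6 8 - d 3 4 8 - d 2 4 5 - d 2 3 6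
  | 8 => d 1 2 7 - d 1 3 6 - d 1 4 5 + d 5 6 7 + d 3 4 7 + d 2 4 6 - d 2 3 5
  | _ => 0
  end.

Definition cayley8 x y z w : K :=
  let d := minor4 x y z w in
  d 1 2 3 4 + d 1 2 5 6 + d 1 2 7 8 + d 1 3 5 7
  - d 1 3 6 8 - d 1 4 5 8 - d 1 4 6 7
  + d 5 6 7 8 + d 3 4 7 8 + d 3 4 5 6 + d 2 4 6 8
  - d 2 4 5 7 - d 2 3 6 7 - d 2 3 5 8.

Lemma cayley8E x y z w : cayley8 x y z w = dot8 (cross8 x y z) w.
Proof.
(* Both sides are linear in the 3 by 3 minors, so these stay opaque and [ring] faces a small
   identity. *)
rewrite /cayley8 /minor4 /dot8 /cross8; move: (minor3 x y z) => d /=.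
by ring.
Qed.

Definition double_cross8 x y a b (n : nat) : K :=
  dot8 x x * (dot8 y b * a n - y n * dot8 a b)
  - dot8 x b * (dot8 y x * a n - y n * dot8 a x)
  + x n * (dot8 y x * dot8 a b - dot8 y b * dot8 a x)
  + (dot8 x x * cross8 y a b n - dot8 x y * cross8 x a b n
     - dot8 x a * cross8 y x b n - dot8 x b * cross8 y a x n
     - x n * dot8 (cross8 y a b) x).

(** For each [n] this is a polynomial identity in the 32 coordinates of [x], [y], [a], [b]. *)
Lemma cross8_double x y a b n : (0 < n < 9)%N ->
  cross8 x (cross8 x y a) b n = double_cross8 x y a b n.
Proof.
case: n => [|[|[|[|[|[|[|[|[|n]]]]]]]]] //= _.
all: by rewrite /double_cross8 /dot8 /cross8 /minor3 /=; ring.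
Qed.

Lemma minor3_swap12 x y z i j k : minor3 y x z i j k = - minor3 x y z i j k.
Proof. by rewrite /minor3; ring. Qed.

Lemma minor3_swap23 x y z i j k : minor3 x z y i j k = - minor3 x y z i j k.
Proof. by rewrite /minor3; ring. Qed.

Lemma minor4_swap34 x y z w i j k l :
  minor4 x y w z i j k l = - minor4 x y z w i j k l.
Proof. by rewrite /minor4 /minor3; ring. Qed.

Lemma minor3_linear c x y z z' i j k :
  minor3 x y (fun n => c * z n + z' n) i j k =
  c * minor3 x y z i j k + minor3 x y z' i j k.
Proof. by rewrite /minor3; ring. Qed.

Lemma cross8_swap12 x y z n : cross8 y x z n = - cross8 x y z n.
Proof.
case: n => [|[|[|[|[|[|[|[|[|n]]]]]]]]]; 
  rewrite /cross8 ?oppr0 // !(minor3_swap12 x y); ring.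
Qed.

Lemma cross8_swap23 x y z n : cross8 x z y n = - cross8 x y z n.
Proof.
case: n => [|[|[|[|[|[|[|[|[|n]]]]]]]]]; 
  rewrite /cross8 ?oppr0 // !(minor3_swap23 x y); ring.
Qed.

Lemma cross8_linear c x y z z' n :
  cross8 x y (fun n => c * z n + z' n) n = c * cross8 x y z n + cross8 x y z' n.
Proof.
case: n => [|[|[|[|[|[|[|[|[|n]]]]]]]]]; 
  rewrite /cross8 ?mulr0 ?addr0 // !minor3_linear; ring.
Qed.

Lemma cayley8_swap34 x y z w : cayley8 x y w z = - cayley8 x y z w.
Proof. by rewrite /cayley8 !(minor4_swap34 x y z w); ring. Qed.

(** Coordinate functions are controlled on the indices 1 to 8 only, so this replaces equality of
    functions when rewriting under [cross8]. *)
Lemma cross8_ext x x' y y' z z' n :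
  (forall m, (0 < m < 9)%N -> x m = x' m) ->
  (forall m, (0 < m < 9)%N -> y m = y' m) ->
  (forall m, (0 < m < 9)%N -> z m = z' m) ->
  cross8 x y z n = cross8 x' y' z' n.
Proof.
move=> ex ey ez.
case: n => [|[|[|[|[|[|[|[|[|n]]]]]]]]] //=;
  by rewrite /minor3 !ex // !ey // !ez.
Qed.

End Coordinates.

(** * Algebra of the triple cross product on row vectors *)

Section CrossProduct.
Variable R : realType.
Implicit Types x y z w a b : 'rV[R]_8.

(** Numbered from 1 as in [dx]; an index outside 1 to 8 gives a junk value. *)
Definition coord8 (x : 'rV[R]_8) (n : nat) : R := x 0 (inord n.-1).

Lemma coord8P x y :
  (forall n, (0 < n < 9)%N -> coord8 x n = coord8 y n) -> x = y.
Proof.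
move=> exy; apply/rowP => i; have := exy i.+1.
by rewrite /coord8 /= inord_val; apply; rewrite ltnS ltn_ord.
Qed.

Lemma coord8D x y n : coord8 (x + y) n = coord8 x n + coord8 y n.
Proof. by rewrite /coord8 mxE. Qed.

Lemma coord8N x n : coord8 (- x) n = - coord8 x n.
Proof. by rewrite /coord8 mxE. Qed.

Lemma coord8Z c x n : coord8 (c *: x) n = c * coord8 x n.
Proof. by rewrite /coord8 mxE. Qed.

(** With entries indexed by natural numbers, the minors in [detfS] are again of the form [detf], so
    the expansion can be iterated by rewriting. *)
Definition detf n (f : nat -> nat -> R) := \det (\matrix_(i < n, j < n) f i j).

Lemma detfS n f :
  detf n.+1 f =
  \sum_(k < n.+1) f 0 k * ((-1) ^+ k * detf n (fun i j => f i.+1 (bump k j))).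
Proof.
rewrite /detf (expand_det_row _ ord0); apply: eq_bigr => k _.
rewrite mxE /cofactor.
by congr (_ * (_ * \det _)); apply/matrixP => i j; rewrite !mxE.
Qed.

Lemma dx_minor4 i j k l x y z w :
  dx i j k l (rows4 x y z w) =
  minor4 (coord8 x) (coord8 y) (coord8 z) (coord8 w) i j k l.
Proof.
pose f (r c : nat) :=
  coord8 (nth 0 [:: x; y; z; w] r) (nth 0%N [:: i; j; k; l] c).
have -> : dx i j k l (rows4 x y z w) = detf 4 f.
  by rewrite /dx /detf; congr (\det _); apply/matrixP => r c; rewrite !mxE.
do 4 rewrite !detfS !big_ord_recl !big_ord0 /=.
by rewrite /detf !det_mx00 /f /minor4 /minor3 /bump /=; ring.
Qed.

Lemma euclidE x y : euclid x y = dot8 (coord8 x) (coord8 y).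
Proof.
transitivity (\sum_(i < 8) coord8 x i.+1 * coord8 y i.+1).
  by apply: eq_bigr => i _; rewrite /coord8 inord_val.
by do 8 rewrite big_ord_recr /=; rewrite big_ord0 add0r.
Qed.

Lemma Phi_rows4 x y z w :
  Phi (rows4 x y z w) = cayley8 (coord8 x) (coord8 y) (coord8 z) (coord8 w).
Proof. by rewrite /Phi !dx_minor4. Qed.

Lemma coord8_cross3 x y z n : (0 < n < 9)%N ->
  coord8 (cross3 x y z) n = cross8 (coord8 x) (coord8 y) (coord8 z) n.
Proof.
move=> n8; rewrite {1}/coord8 mxE Phi_rows4 cayley8E.
have cd m : (0 < m < 9)%N ->
    coord8 (delta_mx 0 (inord n.-1) : 'rV[R]_8) m = (m == n)%:R.
  case: m n n8 => // m [] // n.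
  rewrite /coord8 mxE eqxx -val_eqE /= !ltnS => n8 m8.
  by rewrite !inordK // eqSS.
rewrite /dot8 !cd //.
case: n n8 {cd} => [|[|[|[|[|[|[|[|[|n]]]]]]]]] //= _;
  by rewrite ?(mulr0, mulr1, addr0, add0r).
Qed.

Lemma cross3_swap12 x y z : cross3 y x z = - cross3 x y z.
Proof.
by apply: coord8P => n n8; rewrite coord8N !coord8_cross3 // cross8_swap12.
Qed.

Lemma cross3_swap23 x y z : cross3 x z y = - cross3 x y z.
Proof.
by apply: coord8P => n n8; rewrite coord8N !coord8_cross3 // cross8_swap23.
Qed.

Lemma cross3_linear x y : linear (cross3 x y).
Proof.
move=> c z z'; apply: coord8P => n n8.
rewrite coord8D coord8Z !coord8_cross3 // -cross8_linear.
by apply: cross8_ext => // m _; rewrite coord8D coord8Z.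
Qed.

HB.instance Definition _ x y :=
  GRing.isLinear.Build R 'rV[R]_8 'rV[R]_8 _ (cross3 x y) (@cross3_linear x y).

Lemma euclidC x y : euclid x y = euclid y x.
Proof. by apply: eq_bigr => i _; rewrite mulrC. Qed.

Lemma euclidDl x y z : euclid (x + y) z = euclid x z + euclid y z.
Proof. by rewrite -big_split; apply: eq_bigr => i _; rewrite mxE mulrDl. Qed.

Lemma euclidZl c x z : euclid (c *: x) z = c * euclid x z.
Proof.
by rewrite /euclid mulr_sumr; apply: eq_bigr => i _; rewrite mxE mulrA.
Qed.

Lemma euclidNl x z : euclid (- x) z = - euclid x z.
Proof. by rewrite -scaleN1r euclidZl mulN1r. Qed.

Lemma euclid_eq0 x : (euclid x x == 0) = (x == 0).
Proof.
apply/eqP/eqP => [|->]; last by apply: big1 => i _; rewrite mxE mul0r.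
move=> x0; apply/rowP => i; rewrite mxE; apply/eqP; rewrite -sqrf_eq0 expr2.
move/eqP: x0; rewrite psumr_eq0 => [/allP/(_ i)|j _]; last exact: sqr_ge0.
by rewrite mem_index_enum => /(_ isT) /implyP; apply.
Qed.

(** [Phi] is alternating; for fixed [x] and [y] this makes [cross3 x y] skew-adjoint. *)
Lemma euclid_cross3_swap x y z w :
  euclid (cross3 x y z) w = - euclid (cross3 x y w) z.
Proof. by rewrite !cross3P !Phi_rows4 cayley8_swap34. Qed.

Lemma cross3_double x y a b :
  let e := @euclid R in
  cross3 x (cross3 x y a) b =
  e x x *: (e y b *: a - e a b *: y) - e x b *: (e y x *: a - e a x *: y)
  + (e y x * e a b - e y b * e a x) *: x
  + (e x x *: cross3 y a b - e x y *: cross3 x a b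
     - e x a *: cross3 y x b - e x b *: cross3 y a x
     - e (cross3 y a b) x *: x).
Proof.
apply: coord8P => n n8.
rewrite !(coord8D, coord8N, coord8Z) !coord8_cross3 //.
rewrite [LHS](@cross8_ext _ _ (coord8 x) _
  (cross8 (coord8 x) (coord8 y) (coord8 a)) _ (coord8 b)) //; last first.
  by move=> m m8; rewrite coord8_cross3.
rewrite cross8_double // /double_cross8 -!euclidE.
have -> : dot8 (cross8 (coord8 y) (coord8 a) (coord8 b)) (coord8 x) =
    euclid (cross3 y a b) x by rewrite cross3P Phi_rows4 cayley8E.
by ring.
Qed.

Lemma cross3_xx x y : cross3 x y y = 0.
Proof.
(* The product equals its own opposite, so twice the product is zero. *)
have /eqP := cross3_swap23 x y y.
by rewrite -addr_eq0 -mulr2n -scaler_nat scaler_eq0 pnatr_eq0 => /eqP.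
Qed.

Lemma cross3_xxl x y : cross3 x x y = 0.
Proof.
have /eqP := cross3_swap12 x x y.
by rewrite -addr_eq0 -mulr2n -scaler_nat scaler_eq0 pnatr_eq0 => /eqP.
Qed.

Lemma cross3_xyx x y : cross3 x y x = 0.
Proof. by rewrite cross3_swap23 cross3_xxl oppr0. Qed.

(** * The complex structure attached to an orthonormal pair *)

Section OrthonormalPair.
Variables x y : 'rV[R]_8.
Hypotheses (xx : euclid x x = 1) (yy : euclid y y = 1) (xy : euclid x y = 0).

Definition perp a := euclid x a = 0 /\ euclid y a = 0.

(** Pairing the product with [x] or [y] repeats an argument of [Phi]. *)
Lemma cross3_perp a : perp (cross3 x y a).
Proof.
split; rewrite euclidC euclid_cross3_swap ?cross3_xyx ?cross3_xx;
  by rewrite /euclid big1 ?oppr0 // => i _; rewrite mxE mul0r.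
Qed.

(** Orthogonality kills most terms of [cross3_double]. Modulo the span of [x] and [y], replacing [a]
    by [cross3 x y a] trades [cross3 x] for [cross3 y]. *)
Lemma cross3_double_perp a b : perp a -> perp b ->
  cross3 x (cross3 x y a) b =
  cross3 y a b - euclid a b *: y - euclid (cross3 y a b) x *: x.
Proof.
move=> [xa ya] [xb yb]; rewrite cross3_double /=.
rewrite xx xa xb yb xy (euclidC y x) xy (euclidC a x) xa.
rewrite !(mul0r, mulr0, scale0r, scale1r, subr0, add0r, sub0r, oppr0, addr0).
by rewrite addrA [in LHS](addrC _ (cross3 y a b)).
Qed.

(** After a swap of the last two arguments this is [cross3_double] with [b = y]. *)
Lemma cross3_square a : perp a -> cross3 x y (cross3 x y a) = - a.
Proof.
move=> [xa ya]; rewrite cross3_swap23 cross3_double /= cross3_xyx.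
rewrite xx xa xy yy (euclidC y x) xy (euclidC a y) ya (euclidC a x) xa.
rewrite !(mul0r, mulr0, scale0r, scale1r, subr0, add0r, sub0r, oppr0, addr0).
by rewrite /euclid big1 ?scale0r ?subr0 // => i _; rewrite mxE mul0r.
Qed.

(** A skew-adjoint map of square -1 preserves norms. *)
Lemma cross3_isometry a : perp a ->
  euclid (cross3 x y a) (cross3 x y a) = euclid a a.
Proof.
by move=> pa; rewrite euclid_cross3_swap cross3_square // euclidNl opprK.
Qed.

End OrthonormalPair.
End CrossProduct.

(** * The Cayley condition at a single point *)

Section CayleyPlanes.
Variable R : realType.
Implicit Types x y a b X Y : 'rV[R]_8.

Lemma perpC x y a : perp x y a -> perp y x a.
Proof. by case. Qed.

Lemma euclid0l x : euclid 0 x = 0.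
Proof. by apply: big1 => i _; rewrite mxE mul0r. Qed.

(* Modulo the span of x and y, the maps [cross3 x] and [cross3 y] differ by the
   complex structure [cross3 x y], which makes all terms cancel. *)
Lemma cross3_defect x y a b (u v : R) :
  euclid x x = 1 -> euclid y y = 1 -> euclid x y = 0 ->
  perp x y a -> perp x y b ->
  exists c d : R,
    u *: (cross3 x b a + cross3 (cross3 x y a) y b + cross3 x (cross3 x y b) b)
    + v *: (cross3 (cross3 x y a) y a + cross3 x (cross3 x y b) a
            - cross3 a y b) = c *: x + d *: y.
Proof.
move=> xx yy xy pa pb; have yx : euclid y x = 0 by rewrite euclidC.
(* This shape lets [cross3_double_perp] apply with [x] and [y] interchanged. *)
have swap b' : cross3 (cross3 x y a) y b' = cross3 y (cross3 y x a) b'.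
  rewrite cross3_swap12 cross3_swap23 (cross3_swap12 y x).
  by rewrite [in RHS]cross3_swap23 !opprK linearN.
have pa' := perpC pa; have pb' := perpC pb.
rewrite !swap !(cross3_double_perp yy yx) // !(cross3_double_perp xx xy) //.
rewrite !cross3_xx (cross3_swap23 x a b) (cross3_swap12 y a b).
rewrite (cross3_swap23 y a b).
rewrite euclidNl !euclid0l.
set p := euclid (cross3 x a b) y; set q := euclid (cross3 y a b) x.
(* The products [cross3 x a b] and [cross3 y a b] cancel; the witnesses collect the remaining
   multiples of [x] and of [y]. *)
exists (v * q - u * euclid a b - v * euclid a a).
exists (- u * p - u * euclid b b - v * euclid b a).
by apply/rowP => i; rewrite !mxE; ring.
Qed.

(* Here [a], [b] are the s-derivatives of the ruling directions [x], [y],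
   [a'], [b'] their t-derivatives, [a_ss], ... the second derivatives, and
   [g_s], [g_t] the derivatives of the translation part, [u + iv] being the vector
   field and [p + iq] its derivative. *)
Lemma cross3_ruling x y a b a' b' (a_ss b_ss a_st b_st a_ts b_ts a_tt b_tt
    g_s g_t : 'rV[R]_8) (u v p q p' q' : R) :
  euclid x x = 1 -> euclid y y = 1 -> euclid x y = 0 ->
  perp x y a -> perp x y b -> a' = cross3 x y a -> b' = cross3 x y b ->
  a_st = a_ts -> b_st = b_ts -> p' = - q -> q' = p ->
  a_ts = cross3 a y a + cross3 x b a + cross3 x y a_ss ->
  b_ts = cross3 a y b + cross3 x b b + cross3 x y b_ss ->
  a_tt = cross3 a' y a + cross3 x b' a + cross3 x y a_st ->
  b_tt = cross3 a' y b + cross3 x b' b + cross3 x y b_st ->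
  g_s = u *: a_ss + p *: a + (v *: a_ts + q *: a')
        + (- (v *: b_ss + q *: b) + (u *: b_ts + p *: b')) ->
  g_t = u *: a_st + p' *: a + (v *: a_tt + q' *: a')
        + (- (v *: b_st + q' *: b) + (u *: b_tt + p' *: b')) ->
  exists c d : R, g_t = cross3 x y g_s + c *: x + d *: y.
Proof.
move=> xx yy xy pa pb a'E b'E -> -> -> -> atsE btsE -> -> -> ->.
have [c [d cd]] := cross3_defect u v xx yy xy pa pb.
exists c, d; rewrite -[RHS]addrA -cd.
have Ja : cross3 x y a' = - a by rewrite a'E cross3_square.
have Jb : cross3 x y b' = - b by rewrite b'E cross3_square.
have JD z z' : cross3 x y (z + z') = cross3 x y z + cross3 x y z'.
  by rewrite linearD.
have JN z : cross3 x y (- z) = - cross3 x y z by rewrite linearN.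
have JZ k z : cross3 x y (k *: z) = k *: cross3 x y z by rewrite linearZ.
rewrite !(JD, JN, JZ) Ja Jb.
rewrite cross3_xyx add0r in atsE; rewrite cross3_xx addr0 in btsE.
rewrite -a'E -b'E.
move: (cross3 x y a_ts) (cross3 x y b_ts) => Jats Jbts.
rewrite atsE btsE.
(* What is left is linear in the remaining cross products, so they become arbitrary vectors and the
   identity is checked entrywise. *)
move: (cross3 x b a) (cross3 a' y b) (cross3 x b' b) (cross3 a' y a)
  (cross3 x b' a) (cross3 a y b) (cross3 x y a_ss) (cross3 x y b_ss) => *.
by apply/rowP => i; rewrite !mxE; ring.
Qed.

(** Each [dx] is the determinant of a selection of columns, and selecting columns commutes with
    multiplication on the left. *)
Lemma Phi_mulmx (A : 'M[R]_4) (V : 'M[R]_(4, 8)) :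
  Phi (A *m V) = \det A * Phi V.
Proof.
have dxM i j k l : dx i j k l (A *m V) = \det A * dx i j k l V.
  rewrite /dx -det_mulmx; congr (\det _); apply/matrixP => r c.
  by rewrite !mxE; apply: eq_bigr => m _; rewrite !mxE.
by rewrite /Phi !dxM; ring.
Qed.

Lemma gramE m (V : 'M[R]_(m, 8)) i j :
  (V *m V^T) i j = euclid (row i V) (row j V).
Proof. by rewrite mxE; apply: eq_bigr => k _; rewrite !mxE. Qed.

(** * Calibration of one tangent plane *)

Section CayleyPlane.
Variables (x y X : 'rV[R]_8) (c d : R).
Hypotheses (xx : euclid x x = 1) (yy : euclid y y = 1) (xy : euclid x y = 0).

Definition perp_part X : 'rV[R]_8 := X - euclid x X *: x - euclid y X *: y.

Lemma perp_partP : perp x y (perp_part X).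
Proof.
have yx : euclid y x = 0 by rewrite euclidC.
split; rewrite euclidC /perp_part !euclidDl !euclidNl !euclidZl (euclidC X).
  by rewrite xx yx mulr0 mulr1 oppr0 addr0 subrr.
by rewrite yy xy mulr0 mulr1 oppr0 addr0 subrr.
Qed.

(** The shape of the tangent bases in [jac_lie_sum]: [X] is the s-derivative and the last row is the
    t-derivative. [W] below is an orthogonal basis of the same row space when [xi] is nonzero. *)
Let V := rows4 x y X (cross3 x y X + c *: x + d *: y).
Let xi := perp_part X.
Let W := rows4 x y xi (cross3 x y xi).

(** Gram-Schmidt without normalization: rows change only by multiples of [x] and [y], which
    [cross3 x y] annihilates. *)
Lemma cayley_plane_unipotent : exists2 B : 'M[R]_4, \det B = 1 & V = B *m W.
Proof.
(* The lists stop at the diagonal; the default of [nth] supplies the zeros above it. *)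
pose f (i j : nat) : R := nth 0 (nth [::] [:: [:: 1]; [:: 0; 1];
  [:: euclid x X; euclid y X; 1]; [:: c; d; 0; 1]] i) j.
exists (\matrix_(i, j) f i j).
  rewrite det_trig; last first.
    apply/is_trig_mxP => i j; rewrite mxE /f.
    by case: i => [[|[|[|[|?]]]] ?] //; case: j => [[|[|[|[|?]]]] ?].
  by rewrite !big_ord_recl big_ord0 !mxE /f /= !mulr1.
have cX : cross3 x y X = cross3 x y xi.
  rewrite /xi /perp_part 2!linearB /= !linearZ_LR /=.
  by rewrite cross3_xyx cross3_xx !(oppr0, scaler0, addr0).
apply/row_matrixP => i; rewrite row_mul.
have -> : row i (\matrix_(i, j) f i j) *m W =
   f i 0 *: x + f i 1%N *: y + f i 2%N *: xi + f i 3%N *: cross3 x y xi.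
  apply/rowP => k; rewrite !mxE !big_ord_recl big_ord0 !mxE /= addr0 !addrA.
  by [].
apply/rowP => k; rewrite !mxE /f.
case: i => [[|[|[|[|?]]]] ?] //=; rewrite ?cX /xi /perp_part ?mxE; ring.
Qed.

(** The Gram matrix of [W] is diagonal because [cross3 x y] is a skew-adjoint isometry on the
    complement of [x] and [y]. *)
Lemma cayley_plane_gram : \det (V *m V^T) = euclid xi xi ^+ 2.
Proof.
have [B detB ->] := cayley_plane_unipotent.
rewrite trmx_mul -mulmxA (mulmxA W) !det_mulmx det_tr detB mul1r mulr1.
have [xxi yxi] := perp_partP; have [xJ yJ] := cross3_perp x y xi.
have xiJ : euclid xi (cross3 x y xi) = 0.
  by rewrite euclidC; have := euclid_cross3_swap x y xi xi; lra.
have JJ : euclid (cross3 x y xi) (cross3 x y xi) = euclid xi xi.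
  exact: cross3_isometry perp_partP.
have -> : W *m W^T =
    diag_mx (\row_i nth 0 [:: 1; 1; euclid xi xi; euclid xi xi] i).
  apply/matrixP => i j; rewrite gramE /W /rows4 !rowK mxE mxE.
  case: i => [[|[|[|[|?]]]] ?] //; case: j => [[|[|[|[|?]]]] ?] //=;
  rewrite ?mulr1n ?mulr0n //; by rewrite euclidC.
by rewrite det_diag !big_ord_recl big_ord0 !mxE /= !mul1r mulr1.
Qed.

(** By [cross3P], [Phi W] is the squared norm of [cross3 x y xi]. Hence [Phi V] is the nonnegative
    square root of the Gram determinant. *)
Lemma Phi_cayley_plane : Phi V = euclid xi xi.
Proof.
have [B detB ->] := cayley_plane_unipotent.
rewrite Phi_mulmx detB mul1r -cross3P; exact: cross3_isometry perp_partP.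
Qed.

Lemma cayley_plane_row_free : perp_part X != 0 -> row_free V.
Proof.
rewrite -euclid_eq0 => xi0; apply/row_freeP.
(* The right inverse provided by an invertible Gram matrix. *)
exists (V^T *m invmx (V *m V^T)); rewrite mulmxA mulmxV// unitmxE.
by rewrite cayley_plane_gram unitfE expf_neq0.
Qed.

(** Orthonormality forces [\det A * euclid xi xi] to have square 1, and positivity of [\det A]
    selects the value 1. *)
Lemma cayley_plane_calibrated (A : 'M[R]_4) :
  (A *m V) *m (A *m V)^T = 1%:M -> 0 < \det A -> Phi (A *m V) = 1.
Proof.
move=> /(congr1 determinant); rewrite det1 trmx_mul -mulmxA (mulmxA V).
rewrite !det_mulmx det_tr cayley_plane_gram => An A0.
rewrite Phi_mulmx Phi_cayley_plane.
have n0 : 0 <= euclid xi xi by apply: sumr_ge0 => i _; exact: sqr_ge0.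
have /eqP : (\det A * euclid xi xi) ^+ 2 = 1 by rewrite -An; ring.
rewrite sqrf_eq1 => /orP[/eqP //|/eqP E].
by have := mulr_ge0 (ltW A0) n0; rewrite E ler0N1.
Qed.

End CayleyPlane.

Lemma rows4_row_free x y a b : row_free (rows4 x y a b) -> a != 0.
Proof.
move=> free; apply/negP => /eqP a0.
pose i2 : 'I_4 := inord 2.
have : delta_mx 0 i2 *m rows4 x y a b = (0 : 'rV_4) *m rows4 x y a b.
  by rewrite -rowE mul0mx /rows4 rowK inordK.
move/(row_free_inj free) => /matrixP /(_ 0 i2).
by rewrite !mxE !eqxx => /eqP; rewrite oner_eq0.
Qed.

End CayleyPlanes.

(** * Symmetry of second derivatives and product rules *)

Section Derivatives.
Variables (R : realType) (V : normedModType R).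
Implicit Types (v w z : V).

(** The first-order expansion of [f] at [z] is one of [g] as well, and uniqueness identifies the
    differential. *)
Lemma near_eq_differentiable (W : normedModType R) (f g : V -> W) z :
  {near z, f =1 g} -> differentiable f z -> differentiable g z.
Proof.
move=> fg df.
have gE : g \o shift z = cst (g z) + 'd f z +o_ 0 id.
  have fgz := nbhs_singleton fg.
  have fgs : \forall h \near 0, f (h + z) = g (h + z).
    by rewrite (near_shift z)/=; near do rewrite /= sub0r subrK.
  apply/eqaddoP => e e0; have /eqaddoP /(_ e e0) := diff_locally df.
  by apply: filterS2 fgs => h; rewrite !fctE /= -fgz => <-.
apply/diff_locallyP; rewrite (diff_unique (diff_continuous df) gE).
by split => //; exact: diff_continuous.
Unshelve. all: by end_near. Qed.

Lemma derive_line (W : normedModType R) (f : V -> W) v z a :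
  derivable f (a *: v + z) v ->
  is_derive a 1 (fun b : R => f (b *: v + z)) ('D_v f (a *: v + z)).
Proof.
have E : (fun h : R =>
    h^-1 *: (f ((h *: (1 : R) + a) *: v + z) - f (a *: v + z)))
       = (fun h : R => h^-1 *: (f (h *: v + (a *: v + z)) - f (a *: v + z))).
  apply/funext => h; congr (_ *: (f _ - _)).
  by rewrite [h *: 1]mulr1 scalerDl addrA.
move=> df; apply: DeriveDef; rewrite /derivable /derive /=.
  by rewrite [X in cvg (X @ _)]E.
by rewrite [X in lim (X @ _)]E.
Qed.

(** The mean value theorem is used twice: along [v] for the difference of [f] in direction [w], then
    along [w] for ['D_v f]. *)
Lemma second_difference (f : V -> R) v w z (h : R) : 0 < h ->
  (forall a b, 0 <= a <= h -> 0 <= b <= h ->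
     differentiable f (a *: v + (b *: w + z)) /\
     differentiable ('D_v f) (a *: v + (b *: w + z))) ->
  exists a b, [/\ 0 <= a <= h, 0 <= b <= h &
    f (h *: v + (h *: w + z)) - f (h *: v + z) - f (h *: w + z) + f z =
    h ^+ 2 * 'D_w ('D_v f) (a *: v + (b *: w + z))].
Proof.
move=> h0 df.
have hh : 0 <= h <= h by rewrite lexx ltW.
have h00 : 0 <= (0 : R) <= h by rewrite lexx ltW.
pose g (a : R) := f (a *: v + (h *: w + z)) - f (a *: v + z).
have dg a : 0 <= a <= h -> is_derive a 1 g
    ('D_v f (a *: v + (h *: w + z)) - 'D_v f (a *: v + z)).
  move=> ah; apply: is_deriveB; apply: derive_line; apply: diff_derivable.
    exact: (df a h ah hh).1.
  by have := (df a 0 ah h00).1; rewrite scale0r add0r.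
have sub (k k' : R -> R) :
    (forall a, 0 <= a <= h -> is_derive a 1 k (k' a)) ->
    exists2 a, 0 <= a <= h & k h - k 0 = k' a * h.
  move=> dk; have [||a] := @MVT_segment _ k k' 0 h (ltW h0).
  - by move=> a; rewrite in_itv /= => /andP[a0 ah]; apply: dk; rewrite !ltW.
  - apply: derivable_within_continuous => a; rewrite in_itv /= => ah.
    by case: (dk a ah).
  - by rewrite in_itv /= subr0; exists a.
have [a ah] := sub _ _ dg.
pose k (b : R) := 'D_v f (b *: w + (a *: v + z)).
have dk b : 0 <= b <= h ->
    is_derive b 1 k ('D_w ('D_v f) (b *: w + (a *: v + z))).
  move=> bh; apply: derive_line; apply: diff_derivable.
  by have := (df a b ah bh).2; rewrite addrCA.
have [b bh] := sub _ _ dk.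
rewrite /g /k !scale0r !add0r addrCA => -> gE.
exists a, b; split => //.
rewrite [a *: v + _]addrCA [RHS]mulrC expr2 mulrA -gE.
by ring.
Qed.

(** The second difference is symmetric in [v] and [w], so both mixed derivatives share a value at
    points close to [z]; continuity then compares them at [z]. *)
Lemma derive_commute (f : V -> R) v w z :
  (\forall y \near z, differentiable f y) ->
  (\forall y \near z, differentiable ('D_v f) y) ->
  (\forall y \near z, differentiable ('D_w f) y) ->
  {for z, continuous ('D_w ('D_v f))} -> {for z, continuous ('D_v ('D_w f))} ->
  'D_w ('D_v f) z = 'D_v ('D_w f) z.
Proof.
move=> df dvf dwf cwv cvw.
apply/eqP; rewrite -subr_eq0 -normr_le0; apply/ler_addgt0Pl => e e0.
rewrite addr0.
have e20 : 0 < e / 2 by rewrite divr_gt0.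
have cw : \forall y \near z, `|'D_w ('D_v f) z - 'D_w ('D_v f) y| < e / 2.
  by move/cvgrPdist_lt : cwv => /(_ _ e20).
have cv : \forall y \near z, `|'D_v ('D_w f) z - 'D_v ('D_w f) y| < e / 2.
  by move/cvgrPdist_lt : cvw => /(_ _ e20).
have /nbhs_ballP[d /= d0 dball] : \forall y \near z,
    (differentiable f y /\ differentiable ('D_v f) y /\
     differentiable ('D_w f) y) /\
    (`|'D_w ('D_v f) z - 'D_w ('D_v f) y| < e / 2 /\
     `|'D_v ('D_w f) z - 'D_v ('D_w f) y| < e / 2).
  exact: filterI (filterI df (filterI dvf dwf)) (filterI cw cv).
pose N := `|v| + `|w| + 1.
have N0 : 0 < N by rewrite ltr_wpDl // addr_ge0.
(* This keeps the parallelogram of sides [h *: v] and [h *: w] in the ball of radius [d]; the 1 in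
   [N] makes it positive even if [v] and [w] vanish. *)
pose h := d / N / 2.
have h0 : 0 < h by rewrite !divr_gt0.
have inb a b : 0 <= a <= h -> 0 <= b <= h -> ball z d (a *: v + (b *: w + z)).
  move=> /andP[a0 ah] /andP[b0 bh].
  rewrite -ball_normE /ball_ /= addrA opprD addrCA subrr addr0 normrN.
  rewrite (le_lt_trans (ler_normD _ _))// !normrZ !ger0_norm//.
  rewrite (@le_lt_trans _ _ (h * N))//.
    by rewrite /N !mulrDr -[leLHS]addr0 lerD ?lerD ?ler_wpM2r// mulr1 ltW.
  rewrite /h mulrAC divfK ?gt_eqF//.
  by rewrite ltr_pdivrMr// ltr_pMr// ltr1n.
have [|a [b [ah bh E1]]] := @second_difference f v w z h h0.
  by move=> a b ah bh; have [[? []]] := dball _ (inb a b ah bh).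
have [|b' [a' [bh' ah' E2]]] := @second_difference f w v z h h0.
  move=> b' a' bh' ah'; rewrite addrCA.
  by have [[? []]] := dball _ (inb a' b' ah' bh').
have {E1 E2} E : 'D_w ('D_v f) (a *: v + (b *: w + z)) =
            'D_v ('D_w f) (b' *: w + (a' *: v + z)).
  apply: (@mulfI _ (h ^+ 2)); first by rewrite expf_neq0// gt_eqF.
  apply: etrans (esym E1) _; apply: etrans _ E2.
  by rewrite [h *: w + (h *: v + z)]addrCA addrAC [in RHS]addrAC; ring.
have [_ [cw1 _]] := dball _ (inb a b ah bh).
have [_ [_ ]] := dball _ (inb a' b' ah' bh'); rewrite addrCA => cv1.
rewrite -(subrKA ('D_w ('D_v f) (a *: v + (b *: w + z)))).
rewrite (splitr e); apply: (le_trans (ler_normD _ _)); apply: lerD.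
  exact: ltW cw1.
by rewrite E distrC; exact: ltW cv1.
Qed.

Lemma differentiable_mxP m n (f : V -> 'M[R]_(m, n)) z :
  (forall i j, differentiable (fun y => f y i j) z) -> differentiable f z.
Proof.
move=> df.
have -> : f = \sum_(i < m) \sum_(j < n) (fun y => f y i j *: delta_mx i j).
  apply/funext => y; rewrite fct_sumE {1}[f y]matrix_sum_delta.
  by apply: eq_bigr => i _; rewrite fct_sumE.
by do 2 apply: differentiable_sum => ?; exact: differentiableZl.
Qed.

Lemma differentiable_entry m n (f : V -> 'M[R]_(m, n)) z i j :
  differentiable f z -> differentiable (fun y => f y i j) z.
Proof.
by move=> df; exact: (differentiable_comp df (differentiable_coord (f z) i j)).
Qed.

Lemma derive_entry m n (f : V -> 'M[R]_(m, n)) v z i j :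
  differentiable f z -> 'D_v f z i j = 'D_v (fun y => f y i j) z.
Proof. by move=> df; rewrite derive_mx ?mxE//; exact: diff_derivable. Qed.

Section Scale.
Variables (m n : nat).
Implicit Types (k : V -> R) (f : V -> 'M[R]_(m, n)).

Lemma differentiable_scale k f z :
  differentiable k z -> differentiable f z ->
  differentiable (fun y => k y *: f y) z.
Proof.
move=> dk df; apply: differentiable_mxP => i j.
have -> : (fun y => (k y *: f y) i j) = k * (fun y => f y i j).
  by apply/funext => y; rewrite !mxE.
by apply: differentiableM => //; exact: differentiable_entry.
Qed.

Lemma derive_scale k f v z :
  differentiable k z -> differentiable f z ->
  'D_v (fun y => k y *: f y) z = k z *: 'D_v f z + 'D_v k z *: f z.
Proof.
move=> dk df; apply/matrixP => i j.
rewrite derive_entry; last exact: differentiable_scale.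
have -> : (fun y => (k y *: f y) i j) = k * (fun y => f y i j).
  by apply/funext => y; rewrite !mxE.
rewrite deriveM; last 2 first.
- exact: diff_derivable.
- exact/diff_derivable/differentiable_entry.
by rewrite !mxE -derive_entry// [_ *: 'D_v k z]mulrC.
Qed.

End Scale.

Section Apply.
Variables (n m : nat) (L : V -> 'rV[R]_n -> 'rV[R]_m).
Hypothesis linL : forall y, linear (L y).

(** Expanding in the standard basis reduces a varying linear map applied to a varying vector to
    products of scalar and vector functions. *)
Lemma apply_sum y (f : V -> 'rV[R]_n) :
  L y (f y) = \sum_(i < n) f y 0 i *: L y (delta_mx 0 i).
Proof.
pose lM := GRing.isLinear.Build _ _ _ _ _ (linL y).
pose l : {linear 'rV[R]_n -> 'rV[R]_m} := HB.pack (L y) lM.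
rewrite -[L y]/(l : _ -> _) {1}[f y]row_sum_delta linear_sum.
by apply: eq_bigr => i _; rewrite linearZ.
Qed.

Variables (f : V -> 'rV[R]_n) (z : V).
Hypotheses (df : differentiable f z) (dL : forall a, differentiable (L ^~ a) z).

Lemma differentiable_apply : differentiable (fun y => L y (f y)) z.
Proof.
have -> : (fun y => L y (f y)) =
    \sum_(i < n) (fun y => f y 0 i *: L y (delta_mx 0 i)).
  by apply/funext => y; rewrite fct_sumE apply_sum.
apply: differentiable_sum => i; apply: differentiable_scale => //.
exact: differentiable_entry.
Qed.

Lemma derive_apply v :
  'D_v (fun y => L y (f y)) z = 'D_v (L ^~ (f z)) z + L z ('D_v f z).
Proof.
have E (g : V -> 'rV[R]_n) : (fun y => L y (g y)) =
    \sum_(i < n) (fun y => g y 0 i *: L y (delta_mx 0 i)).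
  by apply/funext => y; rewrite fct_sumE apply_sum.
have dg (g : V -> 'rV[R]_n) : differentiable g z ->
    'D_v (fun y => L y (g y)) z =
    \sum_(i < n) (g z 0 i *: 'D_v (L ^~ (delta_mx 0 i)) z
                 + 'D_v g z 0 i *: L z (delta_mx 0 i)).
  move=> gz; rewrite (E g) derive_sum => [|i].
    apply: eq_bigr => i _.
    rewrite derive_scale//; last exact: differentiable_entry.
    by rewrite -derive_entry.
  apply/diff_derivable/differentiable_scale => //.
  exact: differentiable_entry.
(* The same expansion for the constant map [cst (f z)] identifies the first sum as the derivative of
   [L] at a frozen argument. *)
rewrite dg// big_split /= (dg (cst (f z))); last exact: differentiable_cst.
rewrite big_split /= derive_cst.
rewrite [X in _ = _ + X + _]big1 ?addr0 => [|i _]; last first.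
  by rewrite mxE scale0r.
by congr (_ + _); rewrite (apply_sum z (fun=> 'D_v f z)).
Qed.
End Apply.

End Derivatives.

(** * Composition with continuous linear maps *)

Section LinearComposition.
Variables (R : realType) (W W' : normedModType R) (L : W -> W').
Hypotheses (linL : linear L) (contL : continuous L).

Lemma linear_is_diff z : is_diff z L L.
Proof.
pose lM := GRing.isLinear.Build _ _ _ _ _ linL.
pose l : {linear W -> W'} := HB.pack L lM.
apply: DiffDef.
  by have := @linear_differentiable _ _ _ l z contL.
by have := @diff_lin _ _ _ l z contL.
Qed.

Lemma derive_linear v z : 'D_v L z = L v.
Proof.
by have [dL LE] := linear_is_diff z; rewrite deriveE// LE.
Qed.

Lemma differentiable_linear_comp (V : normedModType R) (f : V -> W) z :
  differentiable f z -> differentiable (L \o f) z.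
Proof.
move=> df; apply: differentiable_comp => //.
by have [] := linear_is_diff (f z).
Qed.

Lemma derive_linear_comp (V : normedModType R) (f : V -> W) v z :
  differentiable f z -> 'D_v (L \o f) z = L ('D_v f z).
Proof.
move=> df; have [dL LE] := linear_is_diff (f z).
rewrite deriveE; last exact: differentiable_comp.
by rewrite diff_comp//= LE deriveE.
Qed.

End LinearComposition.

(** * Closure properties of the classes [Cn_on] *)

Section DifferentiabilityClasses.
Variable R : realType.
Local Notation plane := (plane R).
Implicit Types (U : set plane) (W : normedModType R).

(** Since [U] is open, agreement on [U] is agreement near each of its points and passes to [ds] and
    [dt]. *)
Lemma Cn_on_ext W n U (f g : plane -> W) : open U ->
  (forall z, U z -> f z = g z) -> Cn_on n U f -> Cn_on n U g.
Proof.
move=> oU; elim: n f g => [|n IH] f g fg.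
  move=> cf z Uz; rewrite /prop_for /continuous_at -fg//.
  apply: cvg_trans (cf z Uz); apply: near_eq_cvg.
  by near=> y; apply/fg; near: y; exact: open_nbhs_nbhs (conj oU Uz).
have near_fg z : U z -> {near z, f =1 g}.
  by move=> Uz; near=> y; apply/fg; near: y; exact: open_nbhs_nbhs (conj oU Uz).
move=> [df csf ctf]; split.
- by move=> z Uz; apply: near_eq_differentiable (near_fg z Uz) (df z Uz).
- by apply: IH csf => z Uz; apply: near_eq_derive; exact: near_fg.
- by apply: IH ctf => z Uz; apply: near_eq_derive; exact: near_fg.
Unshelve. all: by end_near. Qed.

Lemma Cn_onW W n U (f : plane -> W) : Cn_on n.+1 U f -> Cn_on n U f.
Proof.
elim: n f => [|n IH] f [df cs ct].
  by move=> z Uz; exact/differentiable_continuous/df.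
by split; [exact: df|exact: IH cs|exact: IH ct].
Qed.

Lemma Cn_onD W n U (f g : plane -> W) : open U ->
  Cn_on n U f -> Cn_on n U g -> Cn_on n U (fun z => f z + g z).
Proof.
move=> oU; elim: n f g => [|n IH] f g.
  by move=> cf cg z Uz; apply: continuousD; [exact: cf|exact: cg].
move=> [df sf tf] [dg sg tg]; split.
- by move=> z Uz; apply: differentiableD; [exact: df|exact: dg].
- apply: (Cn_on_ext oU _ (IH _ _ sf sg)) => z Uz.
  by rewrite /ds deriveD//; apply: diff_derivable; [exact: df|exact: dg].
- apply: (Cn_on_ext oU _ (IH _ _ tf tg)) => z Uz.
  by rewrite /dt deriveD//; apply: diff_derivable; [exact: df|exact: dg].
Qed.

(** Induction by the Leibniz rule; the factor left undifferentiated is lowered by [Cn_onW] to the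
    order of the other one. *)
Lemma Cn_on_scale m p n U (k : plane -> R) (f : plane -> 'M[R]_(m, p)) :
  open U ->
  Cn_on n U k -> Cn_on n U f -> Cn_on n U (fun z => k z *: f z).
Proof.
move=> oU; elim: n k f => [|n IH] k f.
  by move=> ck cf z Uz; apply: cvgZ; [exact: ck|exact: cf].
move=> Ck Cf; have [dk sk tk] := Ck; have [df sf tf] := Cf; split.
- by move=> z Uz; apply: differentiable_scale; [exact: dk|exact: df].
- have kf := Cn_onD oU (IH _ _ (Cn_onW Ck) sf) (IH _ _ sk (Cn_onW Cf)).
  apply: (Cn_on_ext oU _ kf) => z Uz.
  by rewrite /ds derive_scale//; [exact: dk|exact: df].
- have kf := Cn_onD oU (IH _ _ (Cn_onW Ck) tf) (IH _ _ tk (Cn_onW Cf)).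
  apply: (Cn_on_ext oU _ kf) => z Uz.
  by rewrite /dt derive_scale//; [exact: dk|exact: df].
Qed.

Lemma Cn_on_linear W W' (L : W -> W') n U (f : plane -> W) : open U ->
  linear L -> continuous L -> Cn_on n U f -> Cn_on n U (fun z => L (f z)).
Proof.
move=> oU linL contL; elim: n f => [|n IH] f.
  by move=> cf z Uz; apply: continuous_comp; [exact: cf|exact: contL].
move=> [df sf tf]; split.
- by move=> z Uz; apply: (differentiable_linear_comp linL contL); exact: df.
- apply: (Cn_on_ext oU _ (IH _ sf)) => z Uz.
  by rewrite /ds -(derive_linear_comp linL contL)//; exact: df.
- apply: (Cn_on_ext oU _ (IH _ tf)) => z Uz.
  by rewrite /dt -(derive_linear_comp linL contL)//; exact: df.
Qed.

Lemma Cn_on_const W n U (a : W) : open U -> Cn_on n U (fun _ => a).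
Proof.
move=> oU; elim: n a => [|n IH] a; first by move=> z _; exact: cvg_cst.
have E v : 'D_v (fun _ : plane => a) = fun _ => 0.
  by apply/funext => z; exact: derive_cst.
split; first by move=> z _; exact: differentiable_cst.
  by rewrite /ds E; exact: IH.
by rewrite /dt E; exact: IH.
Qed.

Lemma smooth_on_differentiable W U (f : plane -> W) z :
  smooth_on U f -> U z -> differentiable f z.
Proof. by move=> /(_ 1) [df _ _]; exact: df. Qed.

Lemma smooth_on_ds W U (f : plane -> W) : smooth_on U f -> smooth_on U (ds f).
Proof. by move=> sf n; have [] := sf n.+1. Qed.

Lemma smooth_on_dt W U (f : plane -> W) : smooth_on U f -> smooth_on U (dt f).
Proof. by move=> sf n; have [] := sf n.+1. Qed.

Lemma dvecE W (a : plane) (f : plane -> W) z :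
  differentiable f z -> dvec a f z = 'D_a f z.
Proof.
move=> df; rewrite /dvec /ds /dt !deriveE// -!linearZ -linearD.
congr ('d f z _).
case: a => a1 a2 /=; congr pair.
  by rewrite /= [_ *: 1]mulr1 [_ *: 0]mulr0 addr0.
by rewrite /= [_ *: 1]mulr1 [_ *: 0]mulr0 add0r.
Qed.

(** The scalar statement [derive_commute] is applied to each entry. *)
Lemma ds_dt m n U (f : plane -> 'M[R]_(m, n)) z : open U -> smooth_on U f ->
  U z -> ds (dt f) z = dt (ds f) z.
Proof.
move=> oU sf Uz; apply/matrixP => i j.
have coordE v (g : plane -> 'M[R]_(m, n)) y : smooth_on U g -> U y ->
    'D_v g y i j = 'D_v (fun x => g x i j) y.
  by move=> sg Uy; rewrite derive_entry//; exact: smooth_on_differentiable Uy.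
have sfij : smooth_on U (fun y => f y i j).
  move=> k; apply: (@Cn_on_linear _ _ (fun A : 'M[R]_(m, n) => A i j)) => //.
    by move=> c A B; rewrite !mxE.
  by move=> A; exact: coord_continuous.
have Unear : nbhs z U by exact: open_nbhs_nbhs (conj oU Uz).
have ssfij := smooth_on_ds sfij; have stfij := smooth_on_dt sfij.
have E1 := coordE (1, 0) _ _ (smooth_on_dt sf) Uz.
have E2 := coordE (0, 1) _ _ (smooth_on_ds sf) Uz.
apply: (etrans E1); apply: (etrans _ (esym E2)) => {E1 E2}.
have E1 : 'D_(1, 0) (fun x => dt f x i j) z = ds (dt (fun x => f x i j)) z.
  by apply: near_eq_derive; apply: filterS Unear => y Uy; exact: coordE.
have E2 : 'D_(0, 1) (fun x => ds f x i j) z = dt (ds (fun x => f x i j)) z.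
  by apply: near_eq_derive; apply: filterS Unear => y Uy; exact: coordE.
apply: (etrans E1); apply: (etrans _ (esym E2)) => {E1 E2}.
apply: derive_commute.
- by apply: filterS Unear => y Uy; exact: smooth_on_differentiable Uy.
- by apply: filterS Unear => y Uy; exact: smooth_on_differentiable Uy.
- by apply: filterS Unear => y Uy; exact: smooth_on_differentiable Uy.
- by apply: (smooth_on_ds stfij 0).
- by apply: (smooth_on_dt ssfij 0).
Qed.

End DifferentiabilityClasses.

(** * The Leibniz rule for the triple product *)

Section CrossLeibniz.
Variables (R : realType) (V : normedModType R).
Implicit Types f g h : V -> 'rV[R]_8.

Lemma cross3_cyclic (x y z : 'rV[R]_8) : cross3 x y z = cross3 y z x.
Proof. by rewrite (cross3_swap23 y x z) (cross3_swap12 x y z) opprK. Qed.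

(** Arguments are set in motion one at a time: here, and in [cross3_diff2] and [derive_cross3], the
    new one occupies the last slot, where linearity is available, after a cyclic rotation if
    needed. *)
Lemma cross3_diff1 f (a b : 'rV[R]_8) z : differentiable f z ->
  differentiable (fun y => cross3 (f y) a b) z /\
  forall v, 'D_v (fun y => cross3 (f y) a b) z = cross3 ('D_v f z) a b.
Proof.
move=> df.
have -> : (fun y => cross3 (f y) a b) = (fun y => cross3 a b (f y)).
  by apply/funext => y; rewrite cross3_cyclic.
pose L := fun _ : V => @cross3 R a b.
have linL y : linear (L y) by exact: cross3_linear.
have dL c : differentiable (L ^~ c) z by exact: differentiable_cst.
split; first exact: (differentiable_apply linL df dL).
move=> v; rewrite (derive_apply linL df dL v) /L derive_cst add0r.
by rewrite [RHS]cross3_cyclic.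
Qed.

Lemma cross3_diff2 f g (b : 'rV[R]_8) z :
  differentiable f z -> differentiable g z ->
  differentiable (fun y => cross3 (f y) (g y) b) z /\
  forall v, 'D_v (fun y => cross3 (f y) (g y) b) z =
    cross3 ('D_v f z) (g z) b + cross3 (f z) ('D_v g z) b.
Proof.
move=> df dg.
have -> : (fun y => cross3 (f y) (g y) b) = (fun y => cross3 b (f y) (g y)).
  by apply/funext => y; rewrite [RHS]cross3_cyclic.
pose L := fun y => cross3 b (f y).
have linL y : linear (L y) by exact: cross3_linear.
have LE c : L ^~ c = fun y => cross3 (f y) c b.
  by apply/funext => y; rewrite /L cross3_cyclic.
have dL c : differentiable (L ^~ c) z.
  by rewrite LE; exact: (cross3_diff1 _ _ df).1.
split; first exact: (differentiable_apply linL dg dL).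
move=> v; rewrite (derive_apply linL dg dL v) LE (cross3_diff1 _ _ df).2.
by congr (_ + _); rewrite /L cross3_cyclic.
Qed.

Lemma derive_cross3 f g h z v :
  differentiable f z -> differentiable g z -> differentiable h z ->
  'D_v (fun y => cross3 (f y) (g y) (h y)) z =
    cross3 ('D_v f z) (g z) (h z) + cross3 (f z) ('D_v g z) (h z)
    + cross3 (f z) (g z) ('D_v h z).
Proof.
move=> df dg dh; pose L := fun y => cross3 (f y) (g y).
have linL y : linear (L y) by exact: cross3_linear.
have dL c : differentiable (L ^~ c) z by exact: (cross3_diff2 _ df dg).1.
by rewrite (derive_apply linL dh dL v) /L (cross3_diff2 _ df dg).2.
Qed.

End CrossLeibniz.

(** * The translation part in one holomorphic coordinate *)

Section LocalRuling.
Variables (R : realType) (U : set (plane R)) (F1 F2 g : plane R -> 'rV[R]_8).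
Variable W : plane R -> plane R.
Hypothesis openU : open U.
Hypotheses (smooth1 : smooth_on U F1) (smooth2 : smooth_on U F2).
Hypothesis unit1 : forall z, U z -> euclid (F1 z) (F1 z) = 1.
Hypothesis unit2 : forall z, U z -> euclid (F2 z) (F2 z) = 1.
Hypothesis orth : forall z, U z -> euclid (F1 z) (F2 z) = 0.
Hypothesis gauge : forall F, F = F1 \/ F = F2 -> forall z, U z ->
  dt F z = cross3 (F1 z) (F2 z) (ds F z) /\
  ds F z = - cross3 (F1 z) (F2 z) (dt F z).
Hypothesis holoW : holo_on U W.
Hypothesis gE : forall z, U z ->
  g z = dvec (W z) F1 z + dvec (mul_i (W z)) F2 z.

Let w1 z : R := (W z).1.
Let w2 z : R := (W z).2.

Lemma smooth_w1 : smooth_on U w1.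
Proof.
move=> n; apply: (@Cn_on_linear _ _ _ (fun a : plane R => a.1 : R)) => //.
  by move=> [a b]; exact: cvg_fst.
exact: holoW.1.
Qed.

Lemma smooth_w2 : smooth_on U w2.
Proof.
move=> n; apply: (@Cn_on_linear _ _ _ (fun a : plane R => a.2 : R)) => //.
  by move=> [a b]; exact: cvg_snd.
exact: holoW.1.
Qed.

Lemma derive_w1 v z : U z -> 'D_v w1 z = ('D_v W z).1.
Proof.
move=> Uz.
apply: (@derive_linear_comp _ _ _ (fun a : plane R => a.1 : R)) => //.
  by move=> [a b]; exact: cvg_fst.
exact: smooth_on_differentiable holoW.1 Uz.
Qed.

Lemma derive_w2 v z : U z -> 'D_v w2 z = ('D_v W z).2.
Proof.
move=> Uz.
apply: (@derive_linear_comp _ _ _ (fun a : plane R => a.2 : R)) => //.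
  by move=> [a b]; exact: cvg_snd.
exact: smooth_on_differentiable holoW.1 Uz.
Qed.

(** Writing [-1 *:] for the opposite puts this term within reach of [Cn_on_scale]. *)
Let g' z := w1 z *: ds F1 z + w2 z *: dt F1 z
  + (-1 *: (w2 z *: ds F2 z) + w1 z *: dt F2 z).

Lemma local_ruling_eq z : U z -> g z = g' z.
Proof.
by move=> Uz; rewrite gE// /dvec /mul_i /g' /w1 /w2 /= scalerA mulN1r.
Qed.

Lemma smooth_local_ruling : smooth_on U g.
Proof.
move=> n; apply: (Cn_on_ext openU (f := g')).
  by move=> z Uz; rewrite local_ruling_eq.
have cst1 : Cn_on n U (fun _ : plane R => -1 : R).
  by apply: (@Cn_on_const).
have S (k : plane R -> R) (F : plane R -> 'rV[R]_8) :
    smooth_on U k -> smooth_on U F -> Cn_on n U (fun z => k z *: F z).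
  by move=> sk sF; apply: Cn_on_scale.
have A1 := S _ _ smooth_w1 (smooth_on_ds smooth1).
have A2 := S _ _ smooth_w2 (smooth_on_dt smooth1).
have A3 := S _ _ smooth_w2 (smooth_on_ds smooth2).
have A4 := S _ _ smooth_w1 (smooth_on_dt smooth2).
exact: (Cn_onD openU (Cn_onD openU A1 A2)
  (Cn_onD openU (Cn_on_scale openU cst1 A3) A4)).
Qed.

(** The grouping of terms is the one that [cross3_ruling] expects for [g_s] and [g_t]. *)
Lemma derive_local_ruling v z : U z ->
  'D_v g z = w1 z *: 'D_v (ds F1) z + 'D_v w1 z *: ds F1 z
    + (w2 z *: 'D_v (dt F1) z + 'D_v w2 z *: dt F1 z)
    + (- (w2 z *: 'D_v (ds F2) z + 'D_v w2 z *: ds F2 z)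
       + (w1 z *: 'D_v (dt F2) z + 'D_v w1 z *: dt F2 z)).
Proof.
move=> Uz.
have -> : 'D_v g z = 'D_v g' z.
  apply: near_eq_derive; have := open_nbhs_nbhs (conj openU Uz).
  by apply: filterS => y Uy; exact: local_ruling_eq.
have d1 := smooth_on_differentiable smooth_w1 Uz.
have d2 := smooth_on_differentiable smooth_w2 Uz.
have ds1 := smooth_on_differentiable (smooth_on_ds smooth1) Uz.
have dt1 := smooth_on_differentiable (smooth_on_dt smooth1) Uz.
have ds2 := smooth_on_differentiable (smooth_on_ds smooth2) Uz.
have dt2 := smooth_on_differentiable (smooth_on_dt smooth2) Uz.
have dd (f : plane R -> 'rV[R]_8) : differentiable f z -> derivable f z v.
  exact: diff_derivable.
have e11 := differentiable_scale d1 ds1.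
have e12 := differentiable_scale d2 dt1.
have e22 := differentiable_scale d2 ds2.
have e21 := differentiable_scale d1 dt2.
have e22' := differentiableZ (-1) e22.
rewrite (deriveD (dd _ (differentiableD e11 e12))
  (dd _ (differentiableD e22' e21))).
rewrite (deriveD (dd _ e11) (dd _ e12)).
rewrite (deriveD (dd _ e22') (dd _ e21)).
rewrite (deriveZ (-1) (dd _ e22)).
rewrite scaleN1r; congr (_ + _ + (- _ + _)).
- exact: derive_scale d1 ds1.
- exact: derive_scale d2 dt1.
- exact: derive_scale d2 ds2.
- exact: derive_scale d1 dt2.
Qed.

Lemma local_ruling_cayley z : U z -> exists c d : R,
  dt g z = cross3 (F1 z) (F2 z) (ds g z) + c *: F1 z + d *: F2 z.
Proof.
move=> Uz.
have [t1 s1] := gauge (or_introl erefl) Uz.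
have [t2 s2] := gauge (or_intror erefl) Uz.
have dF1 := smooth_on_differentiable smooth1 Uz.
have dF2 := smooth_on_differentiable smooth2 Uz.
set x := F1 z in t1 s1 t2 s2 *; set y := F2 z in t1 s1 t2 s2 *.
pose a := ds F1 z; pose b := ds F2 z.
(* The second gauge equation writes [a] as the opposite of a cross product with [x] and [y]. *)
have pa : perp x y a by rewrite /a s1; have [p q] := cross3_perp x y (dt F1 z);
  split; rewrite euclidC euclidNl euclidC ?p ?q oppr0.
have pb : perp x y b by rewrite /b s2; have [p q] := cross3_perp x y (dt F2 z);
  split; rewrite euclidC euclidNl euclidC ?p ?q oppr0.
(* The gauge equation holds on a neighbourhood of [z], so it can be differentiated. *)
have dgauge v F : F = F1 \/ F = F2 -> smooth_on U F -> 'D_v (dt F) z =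
    cross3 ('D_v F1 z) y (ds F z) + cross3 x ('D_v F2 z) (ds F z)
    + cross3 x y ('D_v (ds F) z).
  move=> FE sF.
  have dsF := smooth_on_differentiable (smooth_on_ds sF) Uz.
  apply: etrans _ (derive_cross3 v dF1 dF2 dsF).
  apply: near_eq_derive; have := open_nbhs_nbhs (conj openU Uz).
  by apply: filterS => q Uq; exact: (gauge FE Uq).1.
have CR := holoW.2 z Uz.
have p1 : dt w1 z = - ds w2 z.
  have := congr1 fst CR; rewrite /= => E.
  by apply: etrans (derive_w1 _ Uz) _; rewrite /ds derive_w2.
have p2 : dt w2 z = ds w1 z.
  have := congr1 snd CR; rewrite /= => E.
  by apply: etrans (derive_w2 _ Uz) _; rewrite /ds derive_w1.
apply: (cross3_ruling (unit1 Uz) (unit2 Uz) (orth Uz) pa pb t1 t2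
  (esym (ds_dt openU smooth1 Uz)) (esym (ds_dt openU smooth2 Uz)) p1 p2
  (dgauge (1, 0) F1 (or_introl erefl) smooth1)
  (dgauge (1, 0) F2 (or_intror erefl) smooth2)
  (dgauge (0, 1) F1 (or_introl erefl) smooth1)
  (dgauge (0, 1) F2 (or_intror erefl) smooth2)).
- exact: derive_local_ruling.
- exact: derive_local_ruling.
Qed.

End LocalRuling.

(** * Derivatives along the factors of a product *)

Section PartialDerivatives.
Variables (R : realType) (V V' W : normedModType R) (f : V * V' -> W).

Lemma derive_left v p q : 'D_(v, 0) f (p, q) = 'D_v (fun y => f (y, q)) p.
Proof.
rewrite /derive; set k := (fun _ : R => _); set k' := (fun _ : R => _).
suff -> : k = k' by [].
apply/funext => h; rewrite /k /k' /=; congr (_ *: (f _ - _)).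
by transitivity (h *: v + p, h *: (0 : V') + q); rewrite // scaler0 add0r.
Qed.

Lemma derive_right v p q : 'D_(0, v) f (p, q) = 'D_v (fun y => f (p, y)) q.
Proof.
rewrite /derive; set k := (fun _ : R => _); set k' := (fun _ : R => _).
suff -> : k = k' by [].
apply/funext => h; rewrite /k /k' /=; congr (_ *: (f _ - _)).
by transitivity (h *: (0 : V) + p, h *: v + q); rewrite // scaler0 add0r.
Qed.

End PartialDerivatives.

(** * Lie derivatives and Jacobians in charts *)

Section Surface.
Variables (R : realType) (S : topologicalType) (X : riemann_surface R S).
Local Notation R8 := 'rV[R]_8.

(** The chain rule for the transition map [c \o cinv c']. *)
Lemma dvec_change_chart (c c' : chart R S) (f : S -> R8) x (a : plane R) :
  atlas X c -> atlas X c' -> cdom c x -> cdom c' x -> smooth X f ->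
  dvec a (f \o cinv c') (c' x) =
  dvec (dvec a (c \o cinv c') (c' x)) (f \o cinv c) (c x).
Proof.
move=> ac ac' cx c'x sf.
have dT : differentiable (c \o cinv c') (c' x).
  by apply: smooth_on_differentiable (atlas_holo ac' ac).1 _; exists x.
have Tx : (c \o cinv c') (c' x) = c x by rewrite /= coordK.
have df : differentiable (f \o cinv c) (c x).
  by apply: smooth_on_differentiable (sf c ac) _; exists x.
have df' : differentiable (f \o cinv c') (c' x).
  by apply: smooth_on_differentiable (sf c' ac') _; exists x.
(* Only local, since [coordK] requires [cinv c'] to land in [cdom c]. *)
have fT : {near c' x, f \o cinv c' =1 (f \o cinv c) \o (c \o cinv c')}.
  have : nbhs (c' x) (cinv c' @^-1` cdom c).
    apply: (cinv_continuous c'x); apply: open_nbhs_nbhs; split.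
      exact: cdom_open.
    by rewrite coordK.
  by apply: filterS => z cz; rewrite /= coordK.
rewrite (dvecE _ df') (dvecE _ df) (dvecE _ dT) (near_eq_derive _ fT).
have df2 : differentiable (f \o cinv c) ((c \o cinv c') (c' x)) by rewrite Tx.
rewrite deriveE; last exact: differentiable_comp.
rewrite (diff_comp dT df2) (deriveE _ dT) (deriveE _ df) /=.
by rewrite coordK.
Qed.

(** By the Cauchy-Riemann equation the derivative of [T] is complex linear. *)
Lemma dvec_mul_i (T : plane R -> plane R) z a : dt T z = mul_i (ds T z) ->
  dvec (mul_i a) T z = mul_i (dvec a T z).
Proof.
rewrite /dvec => ->; move: (ds T z) => [u v]; case: a => a b; rewrite /mul_i /=.
by congr pair; rewrite /= /GRing.scale /=; ring.
Qed.

(** Frees [lie] from the arbitrary choice in [chart_at]. Assuming just the transformation rule for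
    [w] lets it serve [vf_i w] too. *)
Lemma lie_chart w (f : S -> R8) (c : chart R S) x :
  (forall c c' x, atlas X c -> atlas X c' -> cdom c x -> cdom c' x ->
     w c' x = dvec (w c x) (c' \o cinv c) (c x)) ->
  smooth X f -> atlas X c -> cdom c x ->
  lie X w f x = dvec (w c x) (f \o cinv c) (c x).
Proof.
move=> ww sf ac cx; rewrite /lie /chart_at; case: (cid2 _) => c' ac' c'x /=.
by rewrite (dvec_change_chart _ ac ac')// (ww c' c).
Qed.

Lemma vf_i_change_chart w c c' x : holo_vector_field X w ->
  atlas X c -> atlas X c' -> cdom c x -> cdom c' x ->
  vf_i w c' x = dvec (vf_i w c x) (c' \o cinv c) (c x).
Proof.
move=> [_ ww] ac ac' cx c'x; rewrite /vf_i (ww c c')// -dvec_mul_i//.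
by apply: (atlas_holo ac ac').2; exists x.
Qed.

Lemma jac_iota (phi1 phi2 psi : S -> R8) (c : chart R S) p : cdom c p.2 ->
  differentiable (phi1 \o cinv c) (c p.2) ->
  differentiable (phi2 \o cinv c) (c p.2) ->
  differentiable (psi \o cinv c) (c p.2) ->
  jac c (Defs.iota phi1 phi2 psi) p =
  rows4 (phi1 p.2) (phi2 p.2)
    (p.1.1 *: ds (phi1 \o cinv c) (c p.2) + p.1.2 *: ds (phi2 \o cinv c) (c p.2)
     + ds (psi \o cinv c) (c p.2))
    (p.1.1 *: dt (phi1 \o cinv c) (c p.2) + p.1.2 *: dt (phi2 \o cinv c) (c p.2)
     + dt (psi \o cinv c) (c p.2)).
Proof.
case: p => [[r1 r2] x] /= cx d1 d2 d3.
have fib (v : plane R) :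
    'D_v (fun q => Defs.iota phi1 phi2 psi (q, cinv c (c x))) (r1, r2) =
    v.1 *: phi1 x + v.2 *: phi2 x.
  rewrite coordK //; pose L (q : plane R) := q.1 *: phi1 x + q.2 *: phi2 x.
  have linL : linear L.
    move=> k [a b] [a' b']; rewrite /L /=.
    by apply/rowP => i; rewrite !mxE /GRing.scale /=; ring.
  have contL : continuous L.
    move=> [a b]; apply: cvgD; apply: cvgZr_tmp;
      [exact: cvg_fst|exact: cvg_snd].
  have dL : derivable L (r1, r2) v.
    by apply: diff_derivable; have [] := linear_is_diff linL contL (r1, r2).
  have -> : (fun q : plane R => Defs.iota phi1 phi2 psi (q, x)) =
      L + cst (psi x).
    by apply/funext.
  by rewrite (deriveD dL (derivable_cst _ _ _)) derive_cst addr0 derive_linear.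
have base (v : plane R) :
    'D_v (fun q => Defs.iota phi1 phi2 psi ((r1, r2), cinv c q)) (c x) =
    r1 *: 'D_v (phi1 \o cinv c) (c x) + r2 *: 'D_v (phi2 \o cinv c) (c x)
    + 'D_v (psi \o cinv c) (c x).
  have -> : (fun q : plane R => Defs.iota phi1 phi2 psi ((r1, r2), cinv c q)) =
    r1 *: (phi1 \o cinv c) + r2 *: (phi2 \o cinv c) + (psi \o cinv c).
    by apply/funext.
  have D (f : plane R -> R8) : differentiable f (c x) -> derivable f (c x) v.
    exact: diff_derivable.
  have e1 := differentiableZ r1 d1; have e2 := differentiableZ r2 d2.
  rewrite (deriveD (D _ (differentiableD e1 e2)) (D _ d3)).
  rewrite (deriveD (D _ e1) (D _ e2)).
  by rewrite (deriveZ _ (D _ d1)) (deriveZ _ (D _ d2)).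
apply/row_matrixP => i; rewrite /jac /rows4 !rowK /=.
case: i => [[|[|[|[|?]]]] ?] //=.
- apply: etrans (derive_left _ _ _ _) _.
  by apply: etrans (fib (1, 0)) _; rewrite /= scale1r scale0r addr0.
- apply: etrans (derive_left _ _ _ _) _.
  by apply: etrans (fib (0, 1)) _; rewrite /= scale1r scale0r add0r.
- by apply: etrans (derive_right _ _ _ _) _; exact: base.
- by apply: etrans (derive_right _ _ _ _) _; exact: base.
Qed.

End Surface.

(** * Global properties of the twisted ruling *)

Section TwistedRuling.
Variables (R : realType) (S : topologicalType) (X : riemann_surface R S).
Variables (phi1 phi2 : S -> 'rV[R]_8) (w : chart R S -> S -> plane R).
Hypotheses (smooth1 : smooth X phi1) (smooth2 : smooth X phi2).
Hypothesis unit1 : forall x, euclid (phi1 x) (phi1 x) = 1.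
Hypothesis unit2 : forall x, euclid (phi2 x) (phi2 x) = 1.
Hypothesis orth : forall x, euclid (phi1 x) (phi2 x) = 0.
Hypothesis gauge : adapted_flat_gauge X phi1 phi2.
Hypothesis holo : holo_vector_field X w.

Let psi x := lie X w phi1 x + lie X (vf_i w) phi2 x.

Lemma lie_sum_chart (c : chart R S) z : atlas X c -> ccod c z ->
  psi (cinv c z) = dvec (w c (cinv c z)) (phi1 \o cinv c) z
    + dvec (mul_i (w c (cinv c z))) (phi2 \o cinv c) z.
Proof.
move=> ac [x cx <-]; rewrite (coordK cx) /psi (lie_chart holo.2 smooth1 ac cx).
by have -> := lie_chart (fun c1 c2 y => @vf_i_change_chart _ _ _ _ c1 c2 y holo)
  smooth2 ac cx.
Qed.

Lemma gauge_chart (c : chart R S) F : atlas X c ->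
  F = phi1 \o cinv c \/ F = phi2 \o cinv c -> forall z, ccod c z ->
  dt F z = cross3 ((phi1 \o cinv c) z) ((phi2 \o cinv c) z) (ds F z) /\
  ds F z = - cross3 ((phi1 \o cinv c) z) ((phi2 \o cinv c) z) (dt F z).
Proof.
move=> ac FE z [x cx <-] /=; rewrite (coordK cx).
by case: FE => ->; [apply: (gauge ac cx (phi := phi1)); left
                   |apply: (gauge ac cx (phi := phi2)); right].
Qed.

Lemma smooth_lie_sum : smooth X psi.
Proof.
move=> c ac; apply: (@smooth_local_ruling _ _ (phi1 \o cinv c)
  (phi2 \o cinv c) _ (w c \o cinv c)).
- exact: ccod_open.
- exact: smooth1.
- exact: smooth2.
- exact: holo.1.
- by move=> z cz; exact: lie_sum_chart.
Qed.

(** The gauge handles the terms in [phi1] and [phi2], [local_ruling_cayley] the term in [psi], and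
    linearity of the cross product combines them for all values of [p.1]. *)
Lemma jac_lie_sum (c : chart R S) p : atlas X c -> cdom c p.2 ->
  exists k l : R, let x := phi1 p.2 in let y := phi2 p.2 in
  let v := p.1.1 *: ds (phi1 \o cinv c) (c p.2)
    + p.1.2 *: ds (phi2 \o cinv c) (c p.2) + ds (psi \o cinv c) (c p.2) in
  jac c (Defs.iota phi1 phi2 psi) p =
  rows4 x y v (cross3 x y v + k *: x + l *: y).
Proof.
move=> ac cx; have Ux : ccod c (c p.2) by exists p.2.
have diff f : smooth X f -> differentiable (f \o cinv c) (c p.2).
  by move=> sf; exact: smooth_on_differentiable (sf c ac) Ux.
have [k [l kl]] : exists k l : R, dt (psi \o cinv c) (c p.2) =
    cross3 (phi1 p.2) (phi2 p.2) (ds (psi \o cinv c) (c p.2))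
    + k *: phi1 p.2 + l *: phi2 p.2.
  rewrite -[in phi1 _](coordK cx) -[in phi2 _](coordK cx).
  apply: (@local_ruling_cayley _ (ccod c) (phi1 \o cinv c) (phi2 \o cinv c)
    (psi \o cinv c) (w c \o cinv c)).
  - exact: ccod_open.
  - exact: smooth1.
  - exact: smooth2.
  - by move=> z _; exact: unit1.
  - by move=> z _; exact: unit2.
  - by move=> z _; exact: orth.
  - by move=> F FE z Uz; exact: gauge_chart.
  - exact: holo.1.
  - by move=> z Uz; exact: lie_sum_chart.
  - exact: Ux.
exists k, l => /=.
rewrite (jac_iota cx (diff _ smooth1) (diff _ smooth2) (diff _ smooth_lie_sum)).
congr rows4; rewrite kl.
have [-> _] := gauge ac cx (phi := phi1) (or_introl erefl).
have [-> _] := gauge ac cx (phi := phi2) (or_intror erefl).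
set x := phi1 p.2; set y := phi2 p.2.
have JD z z' : cross3 x y (z + z') = cross3 x y z + cross3 x y z'.
  by rewrite linearD.
have JZ r z : cross3 x y (r *: z) = r *: cross3 x y z by rewrite linearZ.
by rewrite !JD !JZ !addrA.
Qed.

Lemma gauge_perp (c : chart R S) x (phi : S -> 'rV[R]_8) :
  phi = phi1 \/ phi = phi2 -> atlas X c -> cdom c x ->
  perp (phi1 x) (phi2 x) (ds (phi \o cinv c) (c x)).
Proof.
move=> phiE ac cx; have [_ ->] := gauge ac cx phiE.
have [p q] := cross3_perp (phi1 x) (phi2 x) (dt (phi \o cinv c) (c x)).
by split; rewrite euclidC euclidNl euclidC ?p ?q oppr0.
Qed.

(** The third row of the Jacobian of the cone is a combination of these two derivatives, and it
    cannot vanish. *)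
Lemma cone_ruling_derivative (c : chart R S) p : atlas X c -> cdom c p.2 ->
  row_free (jac c (Defs.iota phi1 phi2 (fun _ => 0)) p) ->
  ds (phi1 \o cinv c) (c p.2) != 0 \/ ds (phi2 \o cinv c) (c p.2) != 0.
Proof.
move=> ac cx; have Ux : ccod c (c p.2) by exists p.2.
have d1 := smooth_on_differentiable (smooth1 ac) Ux.
have d2 := smooth_on_differentiable (smooth2 ac) Ux.
have d0 : differentiable ((fun _ : S => 0 : 'rV[R]_8) \o cinv c) (c p.2).
  exact: differentiable_cst.
have ds0 : ds ((fun _ : S => 0 : 'rV[R]_8) \o cinv c) (c p.2) = 0.
  exact: derive_cst.
rewrite (jac_iota cx d1 d2 d0) => /rows4_row_free; rewrite ds0.
move: (ds (phi1 \o cinv c) (c p.2)) (ds (phi2 \o cinv c) (c p.2)) => a b.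
have [->|] := eqVneq a 0; last by left.
by have [->|] := eqVneq b 0; [rewrite !scaler0 !addr0 eqxx|right].
Qed.

Lemma immersed_lie_sum_dense :
  dense (immersed_at X (Defs.iota phi1 phi2 (fun _ => 0))) ->
  dense (immersed_at X (Defs.iota phi1 phi2 psi)).
Proof.
move=> dense0 O O0 oO; have [[r x] [Ox [c [ac cx free]]]] := dense0 O O0 oO.
pose a := ds (phi1 \o cinv c) (c x); pose b := ds (phi2 \o cinv c) (c x).
pose g_s := ds (psi \o cinv c) (c x).
pose v (q : plane R) := q.1 *: a + q.2 *: b + g_s.
have immersed q : perp_part (phi1 x) (phi2 x) (v q) != 0 ->
    immersed_at X (Defs.iota phi1 phi2 psi) (q, x).
  move=> vq; exists c; split; [exact: ac|exact: cx|].
  have [k [l ->]] := @jac_lie_sum c (q, x) ac cx.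
  exact: cayley_plane_row_free.
(* A direction in the ruling plane along which the s-derivative really changes. *)
have [e e0] : exists e : plane R, e.1 *: a + e.2 *: b != 0.
  have [a0|b0] := cone_ruling_derivative ac cx free.
    by exists (1, 0); rewrite /= scale1r scale0r addr0.
  by exists (0, 1); rewrite /= scale1r scale0r add0r.
(* Either the point found for the cone already works, or a small move along [e] is made. *)
have [pr|pr] := eqVneq (perp_part (phi1 x) (phi2 x) (v r)) 0; last first.
  by exists (r, x); split => //; exact: immersed.
have /nbhs_ballP[d /= d0 dO] : \forall h \near (0 : R), O (h *: e + r, x).
  have [[A B] /= [nA nB] ABO] := open_nbhs_nbhs (conj oO Ox).
  have line : h *: e + r @[h --> (0 : R)] --> 0 *: e + r.
    by apply: cvgD; [apply: cvgZr_tmp; exact: cvg_id|exact: cvg_cst].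
  rewrite scale0r add0r in line.
  have : \forall h \near (0 : R), A (h *: e + r) by exact: line.
  apply: filterS => h Ah.
  by apply: ABO; split; [exact: Ah|exact: nbhs_singleton nB].
have d20 : 0 < d / 2 by rewrite divr_gt0.
exists (d / 2 *: e + r, x); split.
  apply: dO; rewrite -ball_normE /ball_ /= sub0r normrN gtr0_norm//.
  by rewrite ltr_pdivrMr// ltr_pMr// ltr1n.
apply: immersed.
have [xa ya] := gauge_perp (or_introl erefl) ac cx.
have [xb yb] := gauge_perp (or_intror erefl) ac cx.
have vE : v (d / 2 *: e + r) = v r + (d / 2) *: (e.1 *: a + e.2 *: b).
  have affine (a1 a2 a3 : 'rV[R]_8) (t e1 e2 r1 r2 : R) :
      (t * e1 + r1) *: a1 + (t * e2 + r2) *: a2 + a3 =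
      r1 *: a1 + r2 *: a2 + a3 + t *: (e1 *: a1 + e2 *: a2).
    by apply/rowP => i; rewrite !mxE; ring.
  exact: affine.
(* As [a] and [b] are orthogonal to the ruling plane, [perp_part] leaves the increment intact;
   starting from 0 it becomes a nonzero multiple of [e.1 *: a + e.2 *: b]. *)
have perp_partD u t :
    perp_part (phi1 x) (phi2 x) (u + t *: (e.1 *: a + e.2 *: b)) =
    perp_part (phi1 x) (phi2 x) u + t *: (e.1 *: a + e.2 *: b).
  have perp0 z : euclid z a = 0 -> euclid z b = 0 ->
      euclid z (u + t *: (e.1 *: a + e.2 *: b)) = euclid z u.
    move=> za zb; rewrite euclidC euclidDl euclidZl euclidDl !euclidZl.
    by rewrite (euclidC a) (euclidC b) za zb !mulr0 addr0 mulr0 addr0 euclidC.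
  rewrite /perp_part (perp0 _ xa xb) (perp0 _ ya yb).
  by rewrite -!addrA; congr (u + _); rewrite addrC -addrA.
rewrite vE perp_partD.
by rewrite pr add0r scaler_eq0 negb_or e0 gt_eqF.
Qed.

End TwistedRuling.

Theorem theorem4p10 (R : realType) (S : topologicalType)
    (X : riemann_surface R S) (phi1 phi2 : S -> 'rV[R]_8)
    (w : chart R S -> S -> plane R) (psi : S -> 'rV[R]_8)
    (M0 M : set 'rV[R]_8) :
  M0 = [set y | exists (r1 r2 : R) (x : S), y = r1 *: phi1 x + r2 *: phi2 x] ->
  framed_2ruled_cayley X phi1 phi2 (fun _ => 0) M0 ->
  adapted_flat_gauge X phi1 phi2 ->
  holo_vector_field X w ->
  psi = (fun x => lie X w phi1 x + lie X (vf_i w) phi2 x) ->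
  M = [set y | exists (r1 r2 : R) (x : S),
               y = r1 *: phi1 x + r2 *: phi2 x + psi x] ->
  framed_2ruled_cayley X phi1 phi2 psi M.
Proof.
move=> _ [[s1 s2 _ u1 u2 o12 _ dense0] _] gauge holo -> ->; split.
  split.
  - exact: s1.
  - exact: s2.
  - exact: smooth_lie_sum.
  - exact: u1.
  - exact: u2.
  - exact: o12.
  - apply/seteqP; split => [y [r1 [r2 [x ->]]]|y [[[r1 r2] x] _ <-]].
      by exists ((r1, r2), x).
    by exists r1, r2, x.
  - exact: immersed_lie_sum_dense.
(* The orientation given by the holomorphic charts works everywhere, because [Phi] is nonnegative on
   each Jacobian. *)
exists (fun _ => false); split.
  by move=> p _; exact: filterE.
move=> p c A ac cx /= EE; rewrite expr0 mul1r => A0; move: EE.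
have [k [l ->]] := jac_lie_sum s1 s2 u1 u2 o12 gauge holo ac cx.
by move=> EE; exact: cayley_plane_calibrated.
Qed.
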